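(* Let $A\subseteq \mathbb{R}$ be such that $\Delta \subseteq \mathbb{R}\setminus A$, where $\Delta$ is the Cantor set. Then $C_p(H(A))$ contains a closed and discrete set of cardinality $\mathfrak{c}$ and thus is not normal.
   Context: For $A\subseteq\mathbb{R}$, the Hattori space $H(A)$ is the set $\mathbb{R}$ with the topology $\tau(A)$ in which a point $x\in A$ has the local base $\{(x-\varepsilon,x+\varepsilon) : \varepsilon>0\}$ and a point $x\in\mathbb{R}\setminus A$ has the local base $\{[x,x+\varepsilon) : \varepsilon>0\}$. $C_p(X)$ is the space of continuous real-valued functions on $X$ with the topology of pointwise convergence. $\Delta\subseteq[0,1]$ is the usual middle-thirds Cantor set, $\Delta=\bigcap_{n\ge1} C_n$ where $C_n$ is the usual union of $2^n$ closed intervals of length $3^{-n}$. $\mathfrak{c}=2^{\aleph_0}$. *)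

(* Defs.v *)
From HB Require Import structures.
From mathcomp Require Import all_boot all_order all_algebra.
From mathcomp Require Import all_classical all_reals all_analysis.
From mathcomp Require Import lra.

Set Implicit Arguments.
Unset Strict Implicit.
Unset Printing Implicit Defensive.

Import Order.TTheory GRing.Theory Num.Theory.
Import numFieldNormedType.Exports.

Local Open Scope classical_set_scope.
Local Open Scope ring_scope.

Definition hattori (R : realType) (A : set R) : Type := R.

Definition hattori_base (R : realType) (A : set R) (x e : R) : set R :=
  if x \in A then `]x - e, x + e[%classic else `[x, x + e[%classic.

Section hattori_topology.
Variables (R : realType) (A : set R).

HB.instance Definition _ := Choice.copy (hattori A) R.

Definition hattori_nbhs (x : hattori A) : set_system (hattori A) :=
  filter_from [set e : R | 0 < e] (hattori_base A x).

Lemma hattori_base_refl (x e : R) : 0 < e -> hattori_base A x e x.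
Proof.
by move=> e0; rewrite /hattori_base; case: ifP => _ /=; rewrite in_itv /=; lra.
Qed.

Lemma hattori_base_le (x e d : R) :
  d <= e -> hattori_base A x d `<=` hattori_base A x e.
Proof.
by move=> de y; rewrite /hattori_base; case: ifP => _ /=; rewrite !in_itv /=; lra.
Qed.

Lemma hattori_nbhs_filter x : ProperFilter (hattori_nbhs x).
Proof.
apply: filter_from_proper => [|e e0]; last by exists x; exact: hattori_base_refl.
apply: filter_from_filter => [|e d e0 d0]; first by exists 1 => /=.
exists (Num.min e d); first by rewrite /= lt_min e0.
by move=> y xy; split; apply: hattori_base_le xy; rewrite ge_min lexx ?orbT.
Qed.

Lemma hattori_nbhs_singleton x (U : set (hattori A)) : hattori_nbhs x U -> U x.
Proof. by case=> e e0; apply; exact: hattori_base_refl. Qed.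

Lemma hattori_base_open (x e y : R) : 0 < e -> hattori_base A x e y ->
  exists2 d, 0 < d & hattori_base A y d `<=` hattori_base A x e.
Proof.
move=> e0 xy; have [->|yx] := eqVneq y x; first by exists e.
have [a [ay yb aP]] : exists a : R, [/\ a < y, y < x + e &
    forall z, a < z -> z < x + e -> hattori_base A x e z].
  move: xy; rewrite /hattori_base; case: ifP => _ /=; rewrite in_itv /= => xy.
    by exists (x - e); split=> [||z]; rewrite /= ?in_itv /=; lra.
  have xlty : x < y by rewrite lt_neqAle eq_sym yx; lra.
  by exists x; split=> [||z]; rewrite /= ?in_itv /=; lra.
have [d [d0 da db]] : exists d, [/\ 0 < d, d <= y - a & d <= x + e - y].
  exists (Num.min (y - a) (x + e - y)).
  by rewrite !ge_min !lexx orbT; split; rewrite // lt_min; lra.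
exists d => // z; rewrite /hattori_base; case: ifP => _ /=; rewrite in_itv /= => yz.
  by apply: aP; lra.
by apply: aP; lra.
Qed.

Lemma hattori_nbhs_nbhs x (U : set (hattori A)) :
  hattori_nbhs x U -> hattori_nbhs x (hattori_nbhs^~ U).
Proof.
case=> e e0 eU; exists e => // y /(hattori_base_open e0)[d d0 dxy].
by exists d => // z /dxy; exact: eU.
Qed.

HB.instance Definition _ := hasNbhs.Build (hattori A) hattori_nbhs.
HB.instance Definition _ := Nbhs_isNbhsTopological.Build (hattori A)
  hattori_nbhs_filter hattori_nbhs_singleton hattori_nbhs_nbhs.

End hattori_topology.

(* As a type, [Cp R X] carries the subspace topology of the product [R ^ X]. *)
Definition Cp (R : realType) (X : topologicalType) : set {ptws X -> R} :=
  [set f : X -> R | continuous f].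
Arguments Cp : clear implicits.

(* Left endpoints of the 2 ^ n intervals, of length 3 ^- n, that remain after
   n removals of open middle thirds from [0, 1]. *)
Fixpoint cantor_left (R : realType) (n : nat) : seq R :=
  if n is m.+1 then
    flatten [seq [:: a; a + 2 * 3 ^- m.+1] | a <- cantor_left R m]
  else [:: 0].

Definition cantor_level (R : realType) (n : nat) : set R :=
  \bigcup_(a in [set` cantor_left R n]) `[a, a + 3 ^- n]%classic.
Arguments cantor_level : clear implicits.

Definition cantor_ternary (R : realType) : set R :=
  \bigcap_(n in [set n | (1 <= n)%N]) cantor_level R n.
Arguments cantor_ternary : clear implicits.

(* Main.v *)
(* Let [K] be the set of points of the Cantor set lying in [[0, 1/3]]. For [a]
   in [K] the characteristic function of [[a, 1 - a[] is continuous on [H(A)],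
   as [a] and [1 - a] are both in the Cantor set, hence outside [A]. If points
   [b <> a] of [K] tend to [a], these functions have no pointwise cluster point
   in [Cp(H(A))]: it would fail to be right-continuous at [a] if [b] decreases
   to [a], and at [1 - a] if [b] increases to [a]. By compactness of [K], each
   [h] in [Cp(H(A))] thus has a neighborhood meeting the family at most in [h],
   that is, the family is closed and discrete. Since [Cp(H(A))] is separable
   (polynomials with rational coefficients are dense), it is not normal by
   Jones' lemma. *)
Require Import Defs.
From HB Require Import structures.
From mathcomp Require Import all_boot all_order all_algebra.
From mathcomp Require Import all_classical all_reals all_analysis.
From mathcomp Require Import lra ring.

Set Implicit Arguments.
Unset Strict Implicit.
Unset Printing Implicit Defensive.

Import Order.TTheory GRing.Theory Num.Theory.
Import numFieldNormedType.Exports.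

Local Open Scope classical_set_scope.
Local Open Scope ring_scope.
Local Open Scope card_scope.

(** * Jones' lemma *)

Lemma sub_closed_discrete (T : topologicalType) (D E : set T) :
  closed D -> D `<=` isolated D -> E `<=` D -> closed E.
Proof.
move=> clD discD ED t tE.
have Dt : D t by apply: clD; exact: closureS tE.
have [_ [V Vt VD]] := discD t Dt.
have [y [Ey Vy]] := tE V Vt.
by have <- : y = t by rewrite -[_ = _]/([set t] y) -VD; split=> //; exact: ED.
Qed.

(* Jones: if [T] were normal, sending [E `<=` D] to the trace on the countable
   dense set [Q] of an open set separating [E] from [D `\` E] would be an
   injection of the power set of [D] into the power set of [nat]. *)
Lemma separable_not_normal (R : realType) (T : topologicalType) (Q D : set T) :
  countable Q -> dense Q -> closed D -> D `<=` isolated D ->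
  [set: nat -> bool] #<= D -> ~ normal_space T.
Proof.
move=> /countable_injP[j jinj] dQ clD discD /card_leP[g].
pose f b : T := val (g (to_setT b)).
have finj : injective f.
  move=> b c /val_inj/inj gbc.
  by have /(congr1 val) := gbc (mem_set I) (mem_set I).
have fD b : D (f b) by exact: set_valP.
move=> /(@normal_openP R) normT.
have /choice[U UP] : forall E : set T, exists U : set T, E `<=` D ->
    exists V, [/\ open U, open V, E `<=` U, D `\` E `<=` V & U `&` V = set0].
  move=> E; have [ED|nED] := pselect (E `<=` D); last by exists set0.
  have [|||U [V UV]] := normT E (D `\` E).
  - exact: sub_closed_discrete ED.
  - by apply: (sub_closed_discrete clD discD) => x [].
  - by rewrite -subset0 => x [Ex []].
  - by exists U => _; exists V.
pose code (E : set T) (n : nat) := `[< exists2 q, (U E `&` Q) q & j q = n >].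
have code_sub E F : E `<=` D -> F `<=` D -> code E = code F -> E `<=` F.
  move=> ED FD cEF x Ex; apply: contrapT => nFx.
  have [_ [oU _ EU _ _]] := UP E ED.
  have [V [_ oV _ FV UV0]] := UP F FD.
  (* The dense [Q] meets this neighborhood of [x] at some [q]; equality of the codes then puts [q]
     in [U F], which is disjoint from [V]. *)
  have [] := dQ (U E `&` V); last 1 first.
  - move=> q [[Uq Vq] Qq].
    have : code E (j q) by apply/asboolP; exists q.
    rewrite cEF => /asboolP[q' [UFq' Qq'] /jinj q'q].
    rewrite !inE in q'q; have {}q'q := q'q Qq' Qq.
    by rewrite -[False]/(set0 q) -UV0; split=> //; rewrite -q'q.
  - by exists x; split; [exact: EU | apply: FV; split => //; exact: ED].
  - exact: openI.
have code_inj E F : E `<=` D -> F `<=` D -> code E = code F -> E = F.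
  by move=> ED FD cEF; apply/seteqP; split; apply: code_sub.
(* Cantor's diagonal set: [f b] is kept when [b] codes a subset of [D] that omits [f b]. Membership
   of [f (code E)] in it is contradictory. *)
pose E := [set f b | b in
  [set b | exists F : set T, [/\ F `<=` D, code F = b & ~ F (f b)]]].
have ED : E `<=` D by move=> _ [b _ <-].
have nE : ~ E (f (code E)).
  move=> [b [F [FD cF nF]]] /finj bE.
  apply: (nF); rewrite (code_inj F E) ?cF// bE.
  by exists (code E) => //; exists F; rewrite -bE.
by apply: (nE); exists (code E) => //; exists E.
Qed.

(** * Pointwise convergence in [Cp] *)

Section Cp_topology.
Context {R : realType} {X : topologicalType}.
Implicit Types (g h : Cp R X) (x : X).

Lemma Cp_continuous g : continuous (val g : X -> R).
Proof. by have := set_valP g. Qed.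

Lemma Cp_eval_cvg h x : val g x @[g --> h] --> val h x.
Proof.
have : (set_val : Cp R X -> {ptws X -> R}) @ h --> val h.
  exact: (@initial_continuous (Cp R X) _ set_val h).
move=> hc; apply: (iffLR (@pointwise_cvgP X R _ (val h) _) hc x).
exact: (@fmap_filter _ _ _ (nbhs h) (nbhs_filter h)).
Qed.

Lemma Cp_cvg (F : set_system (Cp R X)) h : Filter F ->
  (forall x, val g x @[g --> F] --> val h x) -> F --> h.
Proof.
move=> FF Fh.
have : {ptws, (set_val : Cp R X -> {ptws X -> R}) @ F --> val h}.
  by apply/pointwise_cvgP.
move=> Fh' U [_ [[B oB <-] Bh BU]].
apply: filterS BU _; apply: Fh'.
exact: open_nbhs_nbhs.
Qed.

Lemma near_Cp_neq h x (r : R) : val h x != r -> \forall g \near h, val g x != r.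
Proof.
move=> hr; have : nbhs (val h x) [set y | y != r].
  by apply: open_nbhs_nbhs; split=> //; exact: open_neq.
exact: Cp_eval_cvg.
Qed.

End Cp_topology.

(** * Separability of [Cp] by rational polynomials *)

Lemma poly_interpolation (F : fieldType) (T : eqType) (i f : T -> F)
    (s : seq T) : injective i ->
  exists p : {poly F}, forall t, t \in s -> p.[i t] = f t.
Proof.
move=> iinj; elim: s => [|u s [p ps]]; first by exists 0.
have [us|us] := boolP (u \in s).
  by exists p => t; rewrite inE => /predU1P[->|]; exact: ps.
(* Newton's step: [w] vanishes at the earlier nodes and, as [i] is injective, not at [i u]. *)
pose w := \prod_(a <- map i s) ('X - a%:P).
have wu : w.[i u] != 0.
  have := root_prod_XsubC (map i s) (i u).
  by rewrite mem_map// (negbTE us) => /negbT.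
exists (p + ((f u - p.[i u]) / w.[i u])%:P * w) => t.
rewrite inE hornerD hornerM hornerC => /predU1P[->|ts].
  by rewrite divfK// addrC subrK.
have /rootP -> : root w (i t) by rewrite root_prod_XsubC map_f.
by rewrite mulr0 addr0 ps.
Qed.

Lemma rat_poly_approx (R : realType) (p : {poly R}) (s : seq R) (e : R) :
  0 < e -> exists q : {poly rat},
    forall x, x \in s -> `|p.[x] - (map_poly ratr q).[x]| < e.
Proof.
elim/poly_ind: p e => [|p c IHp] e e0.
  by exists 0 => x _; rewrite rmorph0 subrr normr0.
(* [M] bounds the nodes, so an error [e / 2 / M] grows to at most [e / 2] on multiplication by ['X];
   the summand 1 keeps [M] positive. *)
pose M : R := 1 + \sum_(x <- s) `|x|.
have sM x : x \in s -> `|x| <= M.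
  move=> xs; rewrite /M (big_rem x)//= addrCA lerDl addr_ge0//.
  exact: sumr_ge0.
have M0 : 0 < M by rewrite ltr_pwDl// sumr_ge0.
have [q qs] := IHp (e / 2 / M) ltac:(by rewrite !divr_gt0).
have [d dc] : exists d : rat, `|c - ratr d| < e / 2.
  have [|d] := @rat_in_itvoo R (c - e / 2) (c + e / 2); first by lra.
  by rewrite in_itv/= => cd; exists d; rewrite ltr_norml; lra.
exists (q * 'X + d%:P) => x xs.
rewrite rmorphD rmorphM/= map_polyX map_polyC/= !hornerMXaddC.
have -> : p.[x] * x + c - ((map_poly ratr q).[x] * x + ratr d) =
  (p.[x] - (map_poly ratr q).[x]) * x + (c - ratr d) by ring.
apply: (le_lt_trans (ler_normD _ _)); rewrite normrM.
have : `|p.[x] - (map_poly ratr q).[x]| * `|x| <= e / 2 / M * M.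
  by apply: ler_pM => //; [exact/ltW/qs | exact: sM].
by rewrite divfK ?gt_eqF//; lra.
Qed.

Lemma Cp_separable (R : realType) (X : topologicalType) (i : X -> R) :
  continuous i -> injective i ->
  exists Q : set (Cp R X), countable Q /\ dense Q.
Proof.
move=> ic iinj.
have pc (q : {poly rat}) : Cp R X (fun t => (map_poly ratr q).[i t]).
  move=> t; apply: (@continuous_comp _ _ _ i (horner (map_poly ratr q))).
    exact: ic.
  exact: continuous_horner.
pose P q : Cp R X := SigSub (mem_set (pc q)).
exists (range P); split.
  apply: card_le_trans (card_image_le _ _) _; exact: countableP.
move=> O [h Oh] oO.
pose B (se : seq X * R) :=
  [set g : Cp R X | range P g /\
    forall t, t \in se.1 -> `|val h t - val g t| < se.2].
(* [F] converges to [h], so [O] contains some [B (s, e)]; interpolating [h] on [s] and then rounding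
   the coefficients gives a point of it. *)
pose F := filter_from [set se : seq X * R | 0 < se.2] B.
have FF : Filter F.
  apply: filter_from_filter; first by exists ([::], 1) => /=.
  move=> [s d] [s' d'] /= d0 d'0; exists (s ++ s', Num.min d d') => /=.
    by rewrite lt_min d0.
  move=> g [Pg gs]; split; split=> //= t ts.
    by have := gs t; rewrite /= mem_cat ts lt_min => /(_ isT)/andP[].
  by have := gs t; rewrite /= mem_cat ts orbT lt_min => /(_ isT)/andP[].
have Fh : F --> h.
  apply: Cp_cvg => t; apply/cvgrPdist_lt => e e0.
  by exists ([:: t], e) => //= g [_]; apply; rewrite mem_head.
have [[s e]/= e0 BO] := Fh O (open_nbhs_nbhs (conj oO Oh)).
have [p ph] := @poly_interpolation R X i (val h) s iinj.
have [q qp] := rat_poly_approx p (map i s) e0.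
exists (P q); split; last by exists q.
by apply: BO; split=> [|t ts /=]; [exists q | rewrite -ph// qp// map_f].
Qed.

(** * Continuous functions on Hattori spaces *)

Section hattori_theory.
Context {R : realType} {A : set R}.
Implicit Types (a x : R).

Lemma hattori_base_sub_ball x e : hattori_base A x e `<=` ball x e.
Proof.
move=> y; rewrite /hattori_base /ball/= ltr_norml.
by case: ifP => _ /=; rewrite in_itv/=; lra.
Qed.

Lemma continuous_hattori_id : continuous (id : hattori A -> R).
Proof.
move=> x U /nbhs_ballP[e /= e0 eU].
by exists e => // y /hattori_base_sub_ball; exact: eU.
Qed.

Lemma nbhs_hattori_right a (U : set R) : ~ A a ->
  nbhs (a : hattori A) U -> exists2 e : R, 0 < e & `[a, a + e[ `<=` U.
Proof.
move=> nAa [e /= e0 eU]; exists e => //.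
by move: eU; rewrite /hattori_base memNset.
Qed.

(** The step is locally constant: basic neighborhoods of [a] stay to its right, and any other [x]
    has a ball that avoids [a]. *)
Lemma continuous_hattori_step a : ~ A a ->
  continuous (fun x : hattori A => (a <= x)%R%:R : R).
Proof.
move=> nAa x; apply: cvg_near_cst; first exact: (@nbhs_filter (hattori A)).
have [->|xa] := eqVneq (x : R) a.
  exists 1; rewrite /= ?ltr01// => y; rewrite /hattori_base memNset//=.
  by rewrite in_itv/= lexx => /andP[->].
have far (y : R) : `|(x : R) - y| < `|(x : R) - a| -> (a <= y) = (a <= (x : R)).
  by rewrite ltr_norml; case: (ger0P ((x : R) - a)) => ? ?; apply/idP/idP; lra.
exists `|(x : R) - a|; first by rewrite /= normr_gt0 subr_eq0.
by move=> y /hattori_base_sub_ball/far/= ->.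
Qed.

(* Where [h] differs from [alpha] at [c], evaluation at [c] separates [h] from
   every [u c']; where [h c = alpha], right-continuity of [h] provides a point
   [x] to the right of [c] at which [h x != beta], and evaluation at [x]
   separates [h] from [u c'] for [c < c' <= x]. *)
Lemma near_Cp_hattori_jump (c r alpha beta : R) (u : R -> R -> R)
    (h : Cp R (hattori A)) : ~ A c -> 0 < r -> alpha != beta ->
  (forall c', c < c' -> c' < c + r -> u c' c = alpha) ->
  (forall c' x, c < c' -> c' <= x -> x < c + r -> u c' x = beta) ->
  exists2 d, 0 < d & \forall g \near h, forall c', c < c' -> c' < c + d ->
    val g <> u c'.
Proof.
move=> nAc r0 ab uc ux; have [hc|hc] := eqVneq (val h (c : hattori A)) alpha.
  have : nbhs (c : hattori A) [set x | val h x != beta].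
    apply: (@Cp_continuous _ _ h (c : hattori A) [set y | y != beta]).
    by apply: open_nbhs_nbhs; split; [exact: open_neq | rewrite /= hc].
  move=> /(nbhs_hattori_right nAc)[e e0 hx].
  have [d [d0 de dr]] : exists d, [/\ 0 < d, d < e & d < r].
    exists (Num.min e r / 2); rewrite divr_gt0 ?lt_min ?e0//.
    by split=> //; rewrite ltr_pdivrMr//; case: (ltP e r) => ?; lra.
  exists d => //.
  have hd : val h (c + d : hattori A) != beta.
    by apply: hx; rewrite /= in_itv/=; lra.
  apply: filterS (near_Cp_neq hd) => g gd c' cc' c'd.
  by apply: contraNnot gd => ->; apply/eqP; apply: ux => //; lra.
exists r => //; apply: filterS (near_Cp_neq hc) => g gc c' cc' c'r.
by apply: contraNnot gc => ->; apply/eqP; exact: uc.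
Qed.

End hattori_theory.

(** * The Cantor set: symmetry, closedness and ternary expansions *)

Section cantor.
Context {R : realType}.
Implicit Types (b : nat -> bool) (n : nat).

Lemma expVn3S n : 3 ^- n = 3 * 3 ^- n.+1 :> R.
Proof. by rewrite exprS invfM mulrA divff// mul1r. Qed.

Lemma cantor_leftS n (a : R) : a \in cantor_left R n ->
  a \in cantor_left R n.+1 /\ a + 2 * 3 ^- n.+1 \in cantor_left R n.+1.
Proof.
by move=> an; split; apply/flatten_mapP; exists a => //;
  rewrite !inE eqxx ?orbT.
Qed.

Lemma cantor_left_sym n (a : R) : a \in cantor_left R n ->
  1 - a - 3 ^- n \in cantor_left R n.
Proof.
elim: n a => [|n IHn] a.
  by rewrite inE => /eqP ->; rewrite expr0 invr1 subr0 subrr mem_head.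
move=> /flatten_mapP[c /IHn/cantor_leftS[c1 c2]].
(* Reflection exchanges the left and right thirds of an interval. *)
rewrite !inE => /predU1P[->|/eqP->].
  suff -> : 1 - c - 3 ^- n.+1 = 1 - c - 3 ^- n + 2 * 3 ^- n.+1 by [].
  by rewrite (expVn3S n); ring.
suff -> : 1 - (c + 2 * 3 ^- n.+1) - 3 ^- n.+1 = 1 - c - 3 ^- n by [].
by rewrite (expVn3S n); ring.
Qed.

Lemma cantor_ternary_sym (a : R) :
  cantor_ternary R a -> cantor_ternary R (1 - a).
Proof.
move=> ca n n1; have [c /cantor_left_sym cn] := ca n n1.
rewrite /= in_itv/= => ac; exists (1 - c - 3 ^- n) => //=.
by rewrite in_itv/=; lra.
Qed.

Lemma closed_cantor_ternary : closed (cantor_ternary R).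
Proof.
apply: closed_bigI => n _; apply: closed_bigcup; first exact: finite_seq.
by move=> a _; exact: interval_closed.
Qed.

(* Ternary expansions with digits 0 and 2. *)
Definition cantor_sum b n : R := \sum_(i < n) (b i)%:R * (2 * 3 ^- i.+1).

Definition cantor_point b : R := sup (range (cantor_sum b)).

Lemma cantor_sumS b n :
  cantor_sum b n.+1 = cantor_sum b n + (b n)%:R * (2 * 3 ^- n.+1).
Proof. exact: big_ord_recr. Qed.

Lemma cantor_sum_left b n : cantor_sum b n \in cantor_left R n.
Proof.
elim: n => [|n /cantor_leftS[]]; first by rewrite /cantor_sum big_ord0 inE.
by rewrite cantor_sumS; case: (b n); rewrite ?mul1r// mul0r addr0.
Qed.

(** The sums increase with [n], while the right endpoints [cantor_sum b n + 3 ^- n] decrease, as a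
    digit adds at most [2 * 3 ^- n.+1]. *)
Lemma cantor_sum_le b m n : cantor_sum b m <= cantor_sum b n + 3 ^- n.
Proof.
have p3 k : 0 < 3 ^- k :> R by rewrite invr_gt0 exprn_gt0.
have [mn|/ltnW] := leqP m n.
  apply: (@le_trans _ _ (cantor_sum b n)); last by rewrite lerDl ltW.
  elim: n mn => [|n IHn]; first by rewrite leqn0 => /eqP ->.
  rewrite leq_eqVlt => /predU1P[->//|/IHn mn]; apply: le_trans mn _.
  by rewrite cantor_sumS lerDl mulr_ge0// mulr_ge0// ltW.
move=> nm; apply: (@le_trans _ _ (cantor_sum b m + 3 ^- m)).
  by rewrite lerDl ltW.
elim: m nm => [|m IHm]; first by rewrite leqn0 => /eqP ->.
rewrite leq_eqVlt => /predU1P[->//|/IHm]; apply: le_trans.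
rewrite cantor_sumS (expVn3S m); have := p3 m.+1.
by case: (b m) => /=; lra.
Qed.

Lemma cantor_point_itv b n :
  cantor_sum b n <= cantor_point b <= cantor_sum b n + 3 ^- n.
Proof.
have ub : ubound (range (cantor_sum b)) (cantor_sum b n + 3 ^- n).
  by move=> _ [m _ <-]; exact: cantor_sum_le.
apply/andP; split.
  by apply: ub_le_sup; [exists (cantor_sum b n + 3 ^- n) | exists n].
by apply: ge_sup => //; exists (cantor_sum b 0); exists 0.
Qed.

Lemma cantor_point_ternary b : cantor_ternary R (cantor_point b).
Proof.
move=> n _; exists (cantor_sum b n); first exact: cantor_sum_left.
by rewrite /= in_itv/=; exact: cantor_point_itv.
Qed.

(** At the first differing digit [n], the two intervals of level [n.+1] are separated by a gap of
    length [3 ^- n.+1]. *)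
Lemma cantor_point_inj : injective cantor_point.
Proof.
move=> b c bc.
suff eqbc n : forall i, (i < n)%N -> b i = c i.
  by apply/funext => n; exact: (eqbc n.+1).
elim: n => // n IHn i; rewrite ltnS leq_eqVlt => /predU1P[->|]; last exact: IHn.
have := cantor_point_itv b n.+1; have := cantor_point_itv c n.+1.
rewrite -bc !cantor_sumS.
have -> : cantor_sum b n = cantor_sum c n.
  by apply: eq_bigr => j _; rewrite IHn.
have : 0 < 3 ^- n.+1 :> R by rewrite invr_gt0 exprn_gt0.
by case: (b n); case: (c n) => //=; lra.
Qed.

End cantor.

(** * Window functions and their index set *)

Section window.
Context {R : realType}.
Implicit Types (a x : R).

(* For [a < 1 - a], the characteristic function of [[a, 1 - a[]. *)
Definition window a x : R := (a <= x)%R%:R - (1 - a <= x)%R%:R.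

Lemma window1 a x : a <= x -> x < 1 - a -> window a x = 1.
Proof. by move=> ax xa; rewrite /window ax lt_geF// subr0. Qed.

Lemma window0_lt a x : x < a -> x < 1 - a -> window a x = 0.
Proof. by move=> xa xa'; rewrite /window !lt_geF// subr0. Qed.

Lemma window0_ge a x : a <= x -> 1 - a <= x -> window a x = 0.
Proof. by move=> ax ax'; rewrite /window ax ax' subrr. Qed.

(** The bound [1 / 3] keeps the jumps at [a] and [1 - a] at least [1 / 3] apart. *)
Definition cantor_third : set R := cantor_ternary R `&` `[0, 1 / 3].

Lemma compact_cantor_third : compact cantor_third.
Proof.
apply: (subclosed_compact _ (@segment_compact R 0 (1 / 3))); last first.
  exact: subIsetr.
by apply: closedI; [exact: closed_cantor_ternary | exact: interval_closed].
Qed.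

Lemma window_inj : {in cantor_third &, injective window}.
Proof.
move=> a b; rewrite !inE => -[_ /=]; rewrite in_itv/= => a13.
move=> [_ /=]; rewrite in_itv/= => b13 ab.
apply: contrapT => /eqP; rewrite neq_lt => /orP[altb|blta].
  have : window a a = window b a by rewrite ab.
  by rewrite window1 ?window0_lt//; [lra|lra|lra].
have : window a b = window b b by rewrite ab.
by rewrite window0_lt ?window1//; lra.
Qed.

Lemma card_cantor_third : cantor_third #= [set: nat -> bool].
Proof.
apply: Cantor_Bernstein; apply/pcard_leP/injfunPex.
  (* A real is determined by the rationals below it, coded by [pickle]; integers that code no
     rational get [false]. *)
  pose cut (x : R) n := if unpickle n is Some q then ratr q < x else false.
  have cutE x (q : rat) : cut x (pickle q) = (ratr q < x).
    by rewrite /cut pickleK.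
  exists cut => // x y _ _ xy; apply: contrapT => /eqP; rewrite neq_lt.
  move=> /orP[] /rat_in_itvoo[q]; rewrite in_itv/= => /andP[q1 q2];
    have := cutE x q; rewrite xy cutE.
    by rewrite q2 lt_gtF.
  by rewrite q2 lt_gtF.
(* A first digit [0] puts the point in the left third. *)
pose s (b : nat -> bool) n := if n is m.+1 then b m else false.
exists (fun b => cantor_point (s b)).
  move=> b _; split; first exact: cantor_point_ternary.
  have := cantor_point_itv (R := R) (s b) 1.
  have := cantor_point_itv (R := R) (s b) 0.
  rewrite /= in_itv/= cantor_sumS /cantor_sum big_ord0 mul0r expr0 expr1.
  by lra.
move=> b c _ _ /cantor_point_inj bc; apply/funext => n.
by have := congr1 (@^~ n.+1) bc.
Qed.

End window.

(** * The closed discrete family of windows *)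

Section closed_discrete.
Context {R : realType} {A : set R} (ternaryA : cantor_ternary R `<=` ~` A).

Lemma window_Cp a : @cantor_third R a -> Cp R (hattori A) (window a).
Proof.
move=> [ca _] x.
have f1 := @continuous_hattori_step R A _ (ternaryA ca) x.
have f2 := @continuous_hattori_step R A _ (ternaryA (cantor_ternary_sym ca)) x.
exact: (@cvgB R R _ _ _ _ _ _ _ f1 f2).
Qed.

Lemma near_window_eq (h : Cp R (hattori A)) :
  \forall g \near h, forall a, cantor_third a -> val g = window a -> g = h.
Proof.
(* By compactness it suffices to treat jointly the [b] near a fixed [a] and the [g] near [h]; the
   cases [b > a], [b < a] and [b = a] use [H1], [H2] and [Ha]. *)
have /compact_near_coveringP cptK := @compact_cantor_third R.
apply: (cptK _ (nbhs h) (fun g a => val g = window a -> g = h)) => a.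
move=> [ca]; rewrite /= in_itv/= => a13.
have [d1 d1_0 H1] : exists2 d, 0 < d & \forall g \near h,
    forall b, a < b -> b < a + d -> val g <> window b.
  (* Since [a <= 1 / 3], radius [1 / 12] stays left of the second jump [1 - b]. *)
  apply: (@near_Cp_hattori_jump _ _ a (1 / 12) 0 1);
    rewrite ?oner_neq0 1?eq_sym//.
  - exact: ternaryA.
  - by move=> b ab ba; apply: window0_lt; lra.
  - by move=> b x ab bx xa; apply: window1; lra.
have [d2 d2_0 H2] : exists2 d, 0 < d & \forall g \near h,
    forall b, 1 - a < b -> b < 1 - a + d -> val g <> window (1 - b).
  (* Reindexing by [1 - b] turns approach to [a] from the left into approach to [1 - a] from the
     right, where the window drops from 1 to 0. *)
  apply: (@near_Cp_hattori_jump _ _ (1 - a) 1 1 0 (fun b => window (1 - b)));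
    rewrite ?oner_neq0//.
  - exact/ternaryA/cantor_ternary_sym.
  - by move=> b ab ba; apply: window1; lra.
  - by move=> b x ab bx xa; apply: window0_ge; lra.
have Ha : \forall g \near h, val g = window a -> g = h.
  have [ha|hna] := pselect (val h = window a).
    by apply: (@nearW _ (nbhs h)) => g; rewrite -ha => /val_inj.
  have [x hx] : exists x, val h x <> window a x.
    by apply/existsNP => hx; apply: hna; exact/funext.
  have /eqP/near_Cp_neq := hx; apply: filterS => g gx ga.
  by move: gx; rewrite ga eqxx.
exists (ball a (Num.min d1 d2), [set g | [/\
    forall b, a < b -> b < a + d1 -> val g <> window b,
    forall b, 1 - a < b -> b < 1 - a + d2 -> val g <> window (1 - b) &
    val g = window a -> g = h]]).
  split => /=; first by apply: nbhsx_ballx; rewrite lt_min d1_0.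
  by apply: filterS3 H1 H2 Ha => g.
move=> [b g] /= [+ [g1 g2 ga]]; rewrite /ball/= lt_min !ltr_norml => abd gb.
have [ba|ab|ba] := ltgtP b a; last by apply: ga; rewrite -ba.
  have := g2 (1 - b); rewrite opprB addrCA subrr addr0 gb.
  by move=> /(_ ltac:(lra) ltac:(lra)).
by have := g1 b ab ltac:(lra).
Qed.

Definition cantor_window (k : @cantor_third R) : Cp R (hattori A) :=
  SigSub (mem_set (window_Cp (set_valP k))).

Lemma cantor_window_inj : injective cantor_window.
Proof.
move=> k l /(congr1 val)/= /window_inj kl.
by apply/val_inj/kl; exact: valP.
Qed.

(** For [h] in the closure of the family this gives closedness, and for [h] in the family
    discreteness. *)
Lemma near_cantor_window (h : Cp R (hattori A)) :
  \forall g \near h, range cantor_window g -> g = h.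
Proof.
apply: filterS (near_window_eq h) => g gh [k _ kg].
by apply: (gh (val k)); [exact: set_valP | rewrite -kg].
Qed.

Lemma closed_cantor_window : closed (range cantor_window).
Proof.
by move=> h /(_ _ (near_cantor_window h))[g [Dg /(_ Dg) <-]].
Qed.

Lemma discrete_cantor_window :
  range cantor_window `<=` isolated (range cantor_window).
Proof.
move=> h Dh; split; first exact: mem_set.
exists [set g | range cantor_window g -> g = h].
  exact: near_cantor_window.
by apply/seteqP; split=> [g [gh Dg]|_ ->]; [exact: gh | split].
Qed.

Lemma card_cantor_window : range cantor_window #= [set: nat -> bool].
Proof.
apply: card_eq_trans card_cantor_third.
apply: card_eq_trans (card_setT _); apply: inj_card_eq => k l _ _.
exact: cantor_window_inj.
Qed.

End closed_discrete.

Theorem theorem11 (R : realType) (A : set R)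
    (hA : cantor_ternary R `<=` ~` A) :
  (exists D : set (Cp R (hattori A)),
     [/\ closed D, D `<=` isolated D & D #= [set: nat -> bool]]) /\
  ~ normal_space (Cp R (hattori A)).
Proof.
have clD := @closed_cantor_window R A hA.
have discD := @discrete_cantor_window R A hA.
have cardD := card_cantor_window hA.
split; first by exists (range (cantor_window hA)).
have [Q [cQ dQ]] := Cp_separable (@continuous_hattori_id R A) (fun _ _ => id).
apply: separable_not_normal cQ dQ clD discD _ => //.
by move: cardD; rewrite card_eq_sym card_eq_le => /andP[].
Qed.
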